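(* Let $p_1,q_1,p_2,q_2$ be pure unit quaternions and let $\alpha_1,\beta_1,\alpha_2,\beta_2\in\mathbb{R}$ satisfy $\cos\alpha_1,\cos\beta_1,\cos\alpha_2,\cos\beta_2\neq 0$. Put $\tilde p_m=p_m\tan\alpha_m$ and $\tilde q_m=q_m\tan\beta_m$ for $m=1,2$, and consider the rotations of $\mathbb{E}^4\cong\mathbb{H}$ $$f(x)=\cos\alpha_1(1+\tilde p_1)\,x\,(1+\tilde q_1)\cos\beta_1,\qquad g(x)=\cos\alpha_2(1+\tilde p_2)\,x\,(1+\tilde q_2)\cos\beta_2 .$$ Let $\alpha,\beta\in\mathbb{R}$ be such that $$\cos\alpha=\cos\alpha_1\cos\alpha_2\,(1-\tilde p_1\cdot\tilde p_2),\qquad \cos\beta=\cos\beta_1\cos\beta_2\,(1-\tilde q_1\cdot\tilde q_2),$$ assume $\cos\alpha\neq0$ and $\cos\beta\neq0$, and set $$\tilde p=\frac{\tilde p_2+\tilde p_1+\tilde p_2\times\tilde p_1}{1-\tilde p_2\cdot\tilde p_1},\qquad \tilde q=\frac{\tilde q_1+\tilde q_2+\tilde q_1\times\tilde q_2}{1-\tilde q_1\cdot\tilde q_2}.$$ Assume that the four quaternions $\tilde p\tan\beta\pm\tilde q\tan\alpha$ and $\tan\alpha\tan\beta\mp\tilde p\tilde q$ are nonzero. Then the composition $h=g\circ f$ is a rotation through the angles $\alpha\pm\beta$ about the planes spanned by the quaternions $\tilde p\tan\beta\pm\tilde q\tan\alpha$ and $\tan\alpha\tan\beta\mp\tilde p\tilde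 q$. That is, the planes $$\mathrm{Sp}\{\tilde p\tan\beta+\tilde q\tan\alpha,\ \tan\alpha\tan\beta-\tilde p\tilde q\}\quad\text{and}\quad \mathrm{Sp}\{\tilde p\tan\beta-\tilde q\tan\alpha,\ \tan\alpha\tan\beta+\tilde p\tilde q\}$$ are mutually orthogonal 2-dimensional subspaces invariant under $h$, and $h$ acts on the first as a rotation through the angle $\alpha+\beta$ and on the second as a rotation through the angle $\alpha-\beta$.
   Context: $\mathbb{H}$ is the algebra of real quaternions $x=x_0+x_1i+x_2j+x_3k$, identified with Euclidean space $\mathbb{E}^4=\mathbb{R}^4$ with its standard scalar product. Write $Sx=x_0$ (real part) and $Vx=x_1i+x_2j+x_3k$ (vector part, identified with a vector of $\mathbb{R}^3$). A pure unit quaternion is a $p=p_1i+p_2j+p_3k$ with $p^2=-1$. For quaternions with zero real part, $\cdot$ and $\times$ denote the scalar and cross products of $\mathbb{R}^3$, and juxtaposition denotes quaternion multiplication. $\mathrm{Sp}\{a,b\}=\{s_1a+s_2b:s_1,s_2\in\mathbb{R}\}$. The map $x\mapsto(\cos\alpha+p\sin\alpha)\,x\,(\cos\beta+q\sin\beta)$, with $p,q$ pure unit quaternions, is a rotation of $\mathbb{E}^4$ (a double rotation, or a simple rotation in case $\cos\alpha=\cos\beta$); when $\cos\alpha,\cos\beta\ne0$ it equals $x\mapsto\cos\alpha(1+\tilde p)x(1+\tilde q)\cos\beta$ with $\tilde p=p\tan\alpha$, $\tilde q=q\tan\beta$ (its Gibbs representation). The angle of rotation in an (unoriented) plane is understood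 up to sign and modulo $2\pi$. *)

(* Defs.v *)
From HB Require Import structures.
From mathcomp Require Import all_boot all_order all_algebra.
From mathcomp Require Import ring.
From mathcomp Require Import all_classical all_reals all_analysis.

Set Implicit Arguments.
Unset Strict Implicit.
Unset Printing Implicit Defensive.

Import Order.TTheory GRing.Theory Num.Theory.
Local Open Scope ring_scope.

Section RowVectors.
Variable R : comNzRingType.

Definition dotv n (u v : 'rV[R]_n) : R := \sum_(i < n) u 0 i * v 0 i.

Definition crossv (u v : 'rV[R]_3) : 'rV[R]_3 :=
  let x1 := u 0 (inord 0) in let y1 := v 0 (inord 0) in
  let x2 := u 0 (inord 1) in let y2 := v 0 (inord 1) in
  let x3 := u 0 (inord 2) in let y3 := v 0 (inord 2) in
  \row_i [:: x2 * y3 - x3 * y2; x3 * y1 - x1 * y3; x1 * y2 - x2 * y1]`_i.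

End RowVectors.

(* x_0 + x_1 i + x_2 j + x_3 k is the row vector (x_0, x_1, x_2, x_3): the
   vector space structure and the scalar product of the quaternions are those
   of the space of row vectors. *)
Definition quat (R : comNzRingType) : Type := 'rV[R]_4.

Section Quaternions.
Variable R : comNzRingType.
Implicit Types x y : quat R.

Definition Quat (a b c d : R) : quat R := \row_i [:: a; b; c; d]`_i.

Definition qcoef x (i : nat) : R := (x : 'rV[R]_4) 0 (inord i).

Lemma quatP x y :
  [/\ qcoef x 0 = qcoef y 0, qcoef x 1 = qcoef y 1,
      qcoef x 2 = qcoef y 2 & qcoef x 3 = qcoef y 3] -> x = y.
Proof.
rewrite /qcoef => -[e0 e1 e2 e3]; apply/rowP => i.
rewrite -(inord_val i); case: i => [[|[|[|[|i]]]] Hi] //=.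
Qed.

Lemma qcoefE a b c d :
  (qcoef (Quat a b c d) 0 = a) * (qcoef (Quat a b c d) 1 = b) *
  (qcoef (Quat a b c d) 2 = c) * (qcoef (Quat a b c d) 3 = d).
Proof. by rewrite /qcoef /Quat !mxE !inordK. Qed.

Definition qmul x y : quat R :=
  let x0 := qcoef x 0 in let x1 := qcoef x 1 in
  let x2 := qcoef x 2 in let x3 := qcoef x 3 in
  let y0 := qcoef y 0 in let y1 := qcoef y 1 in
  let y2 := qcoef y 2 in let y3 := qcoef y 3 in
  Quat (x0 * y0 - x1 * y1 - x2 * y2 - x3 * y3)
       (x0 * y1 + x1 * y0 + x2 * y3 - x3 * y2)
       (x0 * y2 - x1 * y3 + x2 * y0 + x3 * y1)
       (x0 * y3 + x1 * y2 - x2 * y1 + x3 * y0).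

HB.instance Definition _ := Vector.copy (quat R) 'rV[R]_4.

Lemma qcoefD x y i : qcoef (x + y) i = qcoef x i + qcoef y i.
Proof. by rewrite /qcoef mxE. Qed.

Lemma qcoefZ a x i : qcoef (a *: x) i = a * qcoef x i.
Proof. by rewrite /qcoef mxE. Qed.

Fact qmulA : associative qmul.
Proof. by move=> x y z; apply: quatP; rewrite !qcoefE; split; ring. Qed.

Fact qmul1r : left_id (Quat 1 0 0 0) qmul.
Proof. by move=> x; apply: quatP; rewrite !qcoefE; split; ring. Qed.

Fact qmulr1 : right_id (Quat 1 0 0 0) qmul.
Proof. by move=> x; apply: quatP; rewrite !qcoefE; split; ring. Qed.

Fact qmulDl : left_distributive qmul +%R.
Proof.
by move=> x y z; apply: quatP; rewrite !(qcoefD, qcoefE); split; ring.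
Qed.

Fact qmulDr : right_distributive qmul +%R.
Proof.
by move=> x y z; apply: quatP; rewrite !(qcoefD, qcoefE); split; ring.
Qed.

Fact qoner_neq0 : Quat 1 0 0 0 != 0.
Proof.
apply/eqP => /(congr1 (qcoef^~ 0)); rewrite qcoefE /qcoef mxE => /eqP.
by rewrite oner_eq0.
Qed.

HB.instance Definition _ := GRing.Zmodule_isNzRing.Build (quat R)
  qmulA qmul1r qmulr1 qmulDl qmulDr qoner_neq0.

Fact qscalerAl (a : R) x y : a *: (x * y) = (a *: x) * y.
Proof.
by apply: quatP; rewrite !(qcoefZ, qcoefE); split; ring.
Qed.

HB.instance Definition _ := GRing.Lmodule_isLalgebra.Build R (quat R) qscalerAl.

Fact qscalerAr (a : R) x y : a *: (x * y) = x * (a *: y).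
Proof.
by apply: quatP; rewrite !(qcoefZ, qcoefE); split; ring.
Qed.

HB.instance Definition _ := GRing.Lalgebra_isAlgebra.Build R (quat R) qscalerAr.

Definition qre x : R := qcoef x 0.
Definition qvec x : 'rV[R]_3 := \row_i qcoef x i.+1.
Definition quat_of_vec (v : 'rV[R]_3) : quat R :=
  Quat 0 (v 0 (inord 0)) (v 0 (inord 1)) (v 0 (inord 2)).

(* Meant for quaternions with zero real part. *)
Definition qdot x y : R := dotv (qvec x) (qvec y).
Definition qcross x y : quat R := quat_of_vec (crossv (qvec x) (qvec y)).

Definition pure_unit x : Prop := qre x = 0 /\ x ^+ 2 = -1.

End Quaternions.

Section Rotations.
Variable R : realType.

Definition is_rotation n (h : 'rV[R]_n -> 'rV[R]_n) : Prop :=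
  exists A : 'M[R]_n,
    [/\ A *m A^T = 1%:M, \det A = 1 & forall x, h x = x *m A].

Definition gibbs (a b : R) (p q x : quat R) : quat R :=
  (cos a)%:A * (1 + p) * x * (1 + q) * (cos b)%:A.

Definition orthogonal_subspaces (U W : {vspace quat R}) : Prop :=
  forall x y, x \in U -> y \in W -> dotv x y = 0.

Definition invariant_subspace (h : quat R -> quat R) (U : {vspace quat R}) :
    Prop :=
  forall x, x \in U -> h x \in U.

(* The orthonormal basis (u, v) chooses an orientation of the plane U, which
   has none of its own: the angle t is determined up to sign and modulo 2 pi. *)
Definition rotates_plane (h : quat R -> quat R) (U : {vspace quat R}) (t : R) :
    Prop :=
  exists u v : quat R,
    [/\ dotv u u = 1, dotv v v = 1, dotv u v = 0, U = <<[:: u; v]>>%VS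
      & forall r s : R,
          h (r *: u + s *: v) =
            (r * cos t - s * sin t) *: u + (r * sin t + s * cos t) *: v].

End Rotations.

(* Main.v *)
Require Import Defs.
From mathcomp Require Import all_boot all_order all_algebra.
From mathcomp Require Import ring.
From mathcomp Require Import all_classical all_reals all_analysis.

Import Order.TTheory GRing.Theory Num.Theory.
Local Open Scope ring_scope.

(** Write [versor p a] for [cos a + p sin a], where [p] is a pure unit. The
    Gibbs map with parameters [p tan a], [q tan b] is the sandwich
    [x |-> versor p a * x * versor q b], so [h] multiplies on the left by
    [versor p2 alpha2 * versor p1 alpha1] and on the right by
    [versor q1 beta1 * versor q2 beta2].  A product of two versors has norm 1,
    and the product formula for [(1 + x)(1 + y)] with [x], [y] pure identifies
    it ([versorM]): [pt = p tan alpha] for some pure unit [p], and the product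
    is [versor p alpha]; likewise on the right with some [q].  Hence
    [h x = versor p alpha * x * versor q beta].

    The two planes come from comparing left multiplication by [p] with right
    multiplication by [q].  Both are square roots of [-1], they commute, and
    they agree on [{x | p x = x q}], are opposite on [{x | p x = - x q}].  Put
    [w = b_plus], a multiple of [1 - p q].  Then [p w = w q = a_plus], so
    [versor q beta] can be moved across [w] and [h x = versor p (alpha+beta) * x]
    on the span of [w] and [p w]; as [p w] is orthogonal to [w] and as long as
    it, this is a rotation through [alpha + beta] ([sandwich_rotates_plane]).
    The second plane is the same statement for [- q] and [- beta].  The planes
    are orthogonal because multiplication by a unit is an isometry: for [x] in
    the first and [y] in the second,
    [<x, y> = <p x, p y> = - <x q, y q> = - <x, y>].

    Finally a sandwich by versors is orthogonal, and it is the square of the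
    sandwich with halved angles, so its determinant is a square of [1] or [-1]
    ([sandwich_is_rotation]). *)

(** * Coordinates and the scalar product *)

Section Coordinates.
Set Implicit Arguments.
Unset Strict Implicit.
Variable R : comNzRingType.
Implicit Types (x y z p : quat R) (a : R).

Lemma qcoefN x i : qcoef (- x) i = - qcoef x i.
Proof. by rewrite /qcoef mxE. Qed.

Lemma qcoef0 i : qcoef (0 : quat R) i = 0.
Proof. by rewrite /qcoef mxE. Qed.

Lemma qmulE x y : x * y = qmul x y.
Proof. by []. Qed.

Lemma qoneE : (1 : quat R) = Quat 1 0 0 0.
Proof. by []. Qed.

Definition qcoords := (qcoefE, qcoefD, qcoefZ, qcoefN, qcoef0, qmulE, qoneE).

Lemma qdotvE x y :
  dotv x y = qcoef x 0 * qcoef y 0 + qcoef x 1 * qcoef y 1 +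
             qcoef x 2 * qcoef y 2 + qcoef x 3 * qcoef y 3.
Proof.
by rewrite /dotv /qcoef !big_ord_recr big_ord0 /= add0r;
   do ![congr (_ + _)]; congr (x _ _ * y _ _); apply/val_inj; rewrite /= inordK.
Qed.

Lemma qdotE x y :
  qdot x y = qcoef x 1 * qcoef y 1 + qcoef x 2 * qcoef y 2 +
             qcoef x 3 * qcoef y 3.
Proof.
by rewrite /qdot /dotv !big_ord_recr big_ord0 /= add0r !mxE.
Qed.

Lemma qcrossE x y :
  qcross x y = Quat 0 (qcoef x 2 * qcoef y 3 - qcoef x 3 * qcoef y 2)
                      (qcoef x 3 * qcoef y 1 - qcoef x 1 * qcoef y 3)
                      (qcoef x 1 * qcoef y 2 - qcoef x 2 * qcoef y 1).
Proof.
by rewrite /qcross /quat_of_vec /crossv !mxE !inordK.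
Qed.

Lemma qdotC x y : qdot x y = qdot y x.
Proof. by rewrite !qdotE; ring. Qed.

Lemma qdotvC x y : dotv x y = dotv y x.
Proof. by rewrite !qdotvE; ring. Qed.

Lemma qdotvZl a x y : dotv (a *: x) y = a * dotv x y.
Proof. by rewrite !qdotvE !qcoords; ring. Qed.

Lemma qdotvZr a x y : dotv x (a *: y) = a * dotv x y.
Proof. by rewrite !qdotvE !qcoords; ring. Qed.

Lemma qdotvNr x y : dotv x (- y) = - dotv x y.
Proof. by rewrite !qdotvE !qcoords; ring. Qed.

Lemma qdotvMl z x y : dotv (z * x) (z * y) = dotv z z * dotv x y.
Proof. by rewrite !qdotvE !qcoords; ring. Qed.

Lemma qdotvMr z x y : dotv (x * z) (y * z) = dotv z z * dotv x y.
Proof. by rewrite !qdotvE !qcoords; ring. Qed.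

Lemma qdotv_pureMl p x : qre p = 0 -> dotv (p * x) x = 0.
Proof. by rewrite /qre !qdotvE !qcoords => ->; ring. Qed.

Lemma sqr_pure p : qre p = 0 -> p ^+ 2 = - (dotv p p)%:A.
Proof.
rewrite /qre expr2 => p0; apply: quatP.
by rewrite !qdotvE !qcoords p0; split; ring.
Qed.

Lemma pure_unitP p : pure_unit p <-> qre p = 0 /\ dotv p p = 1.
Proof.
split=> -[p0]; last by move=> pp; split=> //; rewrite sqr_pure// pp scale1r.
rewrite sqr_pure// => /oppr_inj/(congr1 (fun x => qcoef x 0)).
by rewrite !qcoords mulr1.
Qed.

Lemma pure_unitN p : pure_unit p -> pure_unit (- p).
Proof. by case=> p0 pp; split; rewrite ?sqrrN// /qre qcoefN [X in - X]p0 oppr0. Qed.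

Lemma mul_one_plus_pure x y : qre x = 0 -> qre y = 0 ->
  (1 + x) * (1 + y) = (1 - qdot x y)%:A + (x + y + qcross x y).
Proof.
rewrite /qre => x0 y0; apply: quatP.
by rewrite !qdotE !qcrossE !qcoords x0 y0; split; ring.
Qed.

End Coordinates.

(** * Versors *)

Section Versors.
Set Implicit Arguments.
Unset Strict Implicit.
Variable R : realType.
Implicit Types (p q x y w u v : quat R) (a b c t r s : R).

Lemma qdotv_ge0 x : 0 <= dotv x x.
Proof. by apply: sumr_ge0 => i _; rewrite -expr2 sqr_ge0. Qed.

Lemma qdotv_eq0 x : dotv x x = 0 -> x = 0.
Proof.
move=> /eqP; rewrite psumr_eq0 => [/allP x0|i _]; last by rewrite -expr2 sqr_ge0.
apply/rowP => i; rewrite mxE; apply/eqP.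
by have := x0 i (mem_index_enum i); rewrite mulf_eq0 orbb.
Qed.

Definition versor p a : quat R := (cos a)%:A + sin a *: p.

Lemma versorNN p a : versor (- p) (- a) = versor p a.
Proof. by rewrite /versor cosN sinN scalerN scaleNr opprK. Qed.

Lemma versorD p a b : pure_unit p ->
  versor p a * versor p b = versor p (a + b).
Proof.
case=> _; rewrite expr2 /versor cosD sinD => pp.
rewrite mulrDl !mulrDr -!scalerAl -!scalerAr !mulr1 !mul1r pp !scalerA.
rewrite addrA scalerN scalerBl scalerDl -!addrA; congr (_ + _).
by rewrite addrC -!addrA addrCA [cos a * sin b]mulrC.
Qed.

Lemma dotv_versor p a : pure_unit p -> dotv (versor p a) (versor p a) = 1.
Proof.
move=> /pure_unitP[]; rewrite /qre !qdotvE /versor !qcoords => -> pp.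
rewrite -[RHS](cos2Dsin2 a) -[in RHS](mulr1 (sin a ^+ 2)) -[in RHS]pp.
by ring.
Qed.

Lemma versor_tan p a : cos a != 0 -> cos a *: (1 + tan a *: p) = versor p a.
Proof. by move=> a0; rewrite scalerDr scalerA /tan mulrCA divff ?mulr1. Qed.

Lemma gibbs_tan p q a b x : cos a != 0 -> cos b != 0 ->
  gibbs a b (tan a *: p) (tan b *: q) x = versor p a * x * versor q b.
Proof.
move=> a0 b0; rewrite /gibbs -versor_tan// -versor_tan//.
by rewrite -!scalerAl -!scalerAr !mul1r mulr1 !scalerAl.
Qed.

(** Comparing norms shows that the pure quaternion [pt] has length
    [|tan a|]; when [tan a = 0] any pure unit serves as [p]. *)
Lemma versorM p1 p2 a1 a2 a : pure_unit p1 -> pure_unit p2 ->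
  cos a1 != 0 -> cos a2 != 0 -> cos a != 0 ->
  let x := tan a1 *: p1 in let y := tan a2 *: p2 in
  cos a = cos a1 * cos a2 * (1 - qdot x y) ->
  exists p, [/\ pure_unit p,
    (1 - qdot x y)^-1 *: (x + y + qcross x y) = tan a *: p &
    versor p1 a1 * versor p2 a2 = versor p a].
Proof.
move=> P1 P2 a1N0 a2N0 aN0 x y aE; set d := 1 - _ in aE *; set z := _ *: _.
have dN0 : d != 0 by apply: contraNneq aN0 => d0; rewrite aE d0 mulr0.
have [x0 y0] : qre x = 0 /\ qre y = 0.
  by case: P1 P2 => + _ [+ _]; rewrite /qre !qcoords => -> ->; rewrite !mulr0.
have prodE : versor p1 a1 * versor p2 a2 = cos a *: (1 + z).
  rewrite -!versor_tan// -scalerAl -scalerAr scalerA mul_one_plus_pure//.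
  have -> : x + y + qcross x y = d *: z by rewrite scalerA divff// scale1r.
  by rewrite -/d -scalerDr scalerA aE.
have z0 : qre z = 0.
  by move: x0 y0; rewrite /z /qre qcrossE !qcoords => -> ->; rewrite !addr0 mulr0.
have zz : dotv z z = tan a ^+ 2.
  have : dotv (cos a *: (1 + z)) (cos a *: (1 + z)) = 1.
    by rewrite -prodE qdotvMl !dotv_versor// mulr1.
  rewrite qdotvZl qdotvZr mulrA -expr2.
  have -> : dotv (1 + z) (1 + z) = 1 + dotv z z.
    by move: z0; rewrite /qre !qdotvE !qcoords => ->; ring.
  rewrite -[RHS](cos2Dsin2 a) mulrDr mulr1 => /addrI zE.
  apply: (@mulfI _ (cos a ^+ 2)); first by rewrite sqrf_eq0.
  by rewrite zE /tan -exprMn mulrCA divff ?mulr1.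
have vE p : z = tan a *: p -> versor p1 a1 * versor p2 a2 = versor p a.
  by move=> zE; rewrite prodE zE versor_tan.
have [t0|tN0] := eqVneq (tan a) 0.
  have zE : z = tan a *: p1.
    by rewrite t0 scale0r; apply: qdotv_eq0; rewrite zz t0 expr0n.
  by exists p1; split=> //; exact: vE.
have zE : z = tan a *: ((tan a)^-1 *: z) by rewrite scalerA divff// scale1r.
exists ((tan a)^-1 *: z); split=> //; last exact: vE.
apply/pure_unitP; split; first by rewrite /qre qcoefZ [qcoef z 0]z0 mulr0.
by rewrite qdotvZl qdotvZr zz; field.
Qed.

(** * Sandwiches by versors *)

Definition sandwich p q a b x : quat R := versor p a * x * versor q b.

Lemma sandwich_iter p q a b x : pure_unit p -> pure_unit q ->
  sandwich p q (a + a) (b + b) x = sandwich p q a b (sandwich p q a b x).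
Proof. by move=> P Q; rewrite /sandwich -!versorD// !mulrA. Qed.

Lemma dotv_sandwich p q a b x y : pure_unit p -> pure_unit q ->
  dotv (sandwich p q a b x) (sandwich p q a b y) = dotv x y.
Proof. by move=> P Q; rewrite qdotvMr qdotvMl !dotv_versor// !mul1r. Qed.

Definition sandwich_mx p q a b : 'M[R]_4 :=
  \matrix_i (sandwich p q a b (delta_mx 0 i : 'rV[R]_4)).

Lemma sandwich_mxE p q a b x : sandwich p q a b x = x *m sandwich_mx p q a b.
Proof.
rewrite /sandwich_mx mulmx_sum_row [in LHS](row_sum_delta x).
rewrite /sandwich mulr_sumr mulr_suml; apply: eq_bigr => i _.
by rewrite rowK -scalerAr -scalerAl.
Qed.

Lemma sandwich_mx_orthogonal p q a b : pure_unit p -> pure_unit q ->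
  sandwich_mx p q a b *m (sandwich_mx p q a b)^T = 1%:M.
Proof.
move=> P Q; apply/matrixP => i j; rewrite mxE.
transitivity (dotv (sandwich p q a b (delta_mx 0 i : 'rV[R]_4))
                   (sandwich p q a b (delta_mx 0 j : 'rV[R]_4))).
  by apply: eq_bigr => k _; rewrite !mxE.
rewrite dotv_sandwich// /dotv (bigD1 i)//= !mxE !eqxx mul1r big1 ?addr0//.
by move=> k /negPf ki; rewrite !mxE ki andbF mul0r.
Qed.

(** Halving both angles writes the matrix as the square of an orthogonal
    matrix, which rules out determinant [-1] without any expansion. *)
Lemma sandwich_is_rotation p q a b : pure_unit p -> pure_unit q ->
  is_rotation (sandwich p q a b).
Proof.
move=> P Q; set B := sandwich_mx p q (a / 2) (b / 2).
have BB : B *m B^T = 1%:M by exact: sandwich_mx_orthogonal.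
exists (B *m B); split.
- by rewrite trmx_mul mulmxA -(mulmxA B B) BB mulmx1.
- by rewrite det_mulmx -{2}det_tr -det_mulmx BB det1.
- move=> x; rewrite {1}(splitr a) {1}(splitr b) sandwich_iter//.
  by rewrite !sandwich_mxE mulmxA.
Qed.

(** * Invariant planes *)

Lemma span2P u v x :
  reflect (exists r s, x = r *: u + s *: v) (x \in <<[:: u; v]>>%VS).
Proof.
rewrite span_cons span_seq1; apply: (iffP memv_addP).
  by move=> [_ /vlineP[r ->] [_ /vlineP[s ->] ->]]; exists r, s.
by move=> [r [s ->]]; exists (r *: u); rewrite ?memvZ ?memv_line//;
   exists (s *: v); rewrite ?memvZ ?memv_line.
Qed.

Lemma rotates_plane_invariant h (U : {vspace quat R}) t :
  rotates_plane h U t -> invariant_subspace h U.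
Proof.
move=> [u [v [_ _ _ -> hE]]] x /span2P[r [s ->]].
by rewrite hE; apply/span2P; exists (r * cos t - s * sin t), (r * sin t + s * cos t).
Qed.

Lemma rotates_plane_dim h (U : {vspace quat R}) t :
  rotates_plane h U t -> \dim U = 2%N.
Proof.
move=> [u [v [uu vv uv -> _]]].
suff /eqP-> : free [:: u; v] by [].
rewrite free_cons seq1_free span_seq1; apply/andP; split.
  apply/vlineP => -[k uE]; move: uv uu; rewrite uE !qdotvZl !qdotvZr vv mulr1.
  by move=> ->; rewrite !mul0r => /esym/eqP; rewrite oner_eq0.
apply/eqP => v0; move: vv; rewrite v0 -(scale0r v) qdotvZl mul0r => /esym/eqP.
by rewrite oner_eq0.
Qed.

Lemma versor_slide p q b w : p * w = w * q -> w * versor q b = versor p b * w.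
Proof.
by move=> pw; rewrite mulrDr mulrDl -!scalerAr -!scalerAl mulr1 mul1r pw.
Qed.

Lemma intertwine_span p q w x : p * w = w * q ->
  x \in <<[:: p * w; w]>>%VS -> p * x = x * q.
Proof.
move=> pw /span2P[r [s ->]].
by rewrite mulrDr mulrDl -!scalerAr -!scalerAl -mulrA -pw.
Qed.

(** On the plane, [p x = x q] lets the right factor cross over and add its
    angle to the left one.  Left multiplication by [p] is then a quarter turn,
    and the rotated orthonormal pair is [w / |w|] followed by its image. *)
Lemma sandwich_rotates_plane p q a b w : pure_unit p -> p * w = w * q ->
  w != 0 -> rotates_plane (sandwich p q a b) <<[:: p * w; w]>>%VS (a + b).
Proof.
move=> P pw w0; have [p0 pp] := P; have [_ p1] := (pure_unitP p).1 P.
have ww : 0 < dotv w w.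
  rewrite lt_neqAle qdotv_ge0 andbT eq_sym.
  by apply: contraNneq w0 => /qdotv_eq0 ->.
pose n := Num.sqrt (dotv w w); have n0 : n != 0 by rewrite gt_eqF// sqrtr_gt0.
have nn : dotv w w = n ^+ 2 by rewrite sqr_sqrtr// ltW.
pose u := n^-1 *: w; have wE : w = n *: u by rewrite scalerA divff ?scale1r.
have uu : dotv u u = 1 by rewrite qdotvZl qdotvZr nn; field.
exists u, (p * u); split=> //.
- by rewrite qdotvMl p1 uu mulr1.
- by rewrite qdotvC qdotv_pureMl.
- apply/vspaceP => x; apply/span2P/span2P => -[r [s ->]].
    exists (s * n), (r * n).
    by rewrite wE -scalerAr !scalerA addrC.
  exists (s / n), (r / n).
  by rewrite -!scalerAr !scalerA addrC.
move=> r s; set x := _ + _.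
have -> : sandwich p q a b x = versor p (a + b) * x.
  rewrite /sandwich -mulrA (@versor_slide p) ?mulrA ?versorD//.
  apply: (@intertwine_span p q w) => //; apply/span2P.
  by exists (s / n), (r / n); rewrite /x -!scalerAr !scalerA addrC.
have ppu : p * (p * u) = - u by rewrite mulrA -expr2 pp mulN1r.
rewrite {}/x; clearbody u.
rewrite /versor mulrDl -!scalerAl mul1r mulrDr -!scalerAr ppu.
rewrite !scalerDr !scalerA !scalerN !scalerDl scaleNr.
rewrite ![_ * r]mulrC ![_ * s]mulrC.
by rewrite [X in _ + X = _]addrC addrACA [X in _ + X = _]addrC.
Qed.

(** Multiplication by a unit quaternion on either side is an isometry. *)
Lemma intertwine_orthogonal p q x y : pure_unit p -> pure_unit q ->
  p * x = x * q -> p * y = - (y * q) -> dotv x y = 0.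
Proof.
move=> /pure_unitP[_ p1] /pure_unitP[_ q1] px py.
have : dotv x y = - dotv x y.
  by rewrite -[LHS]mul1r -p1 -qdotvMl px py qdotvNr qdotvMr q1 mul1r.
by move=> /eqP; rewrite -addr_eq0 -mulr2n mulrn_eq0 => /eqP.
Qed.

(** Since [p] and [q] square to [-1], both products are multiples of
    [p + q]; this is where the spanning quaternions of the planes come from. *)
Lemma intertwiner_one_minus_mul p q c : pure_unit p -> pure_unit q ->
  let w := c *: (1 - p * q) in
  p * w = c *: (p + q) /\ p * w = w * q.
Proof.
move=> [_ pp] [_ qq] w; rewrite /w -scalerAr -scalerAl mulrBr mulrBl mulr1 mul1r.
rewrite mulrA -expr2 pp mulN1r opprK -mulrA -expr2 qq mulrN1 opprK.
by split=> //; rewrite addrC.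
Qed.

End Versors.

Theorem theorem2 (R : realType) (p1 q1 p2 q2 : quat R)
    (alpha1 beta1 alpha2 beta2 alpha beta : R) :
  pure_unit p1 -> pure_unit q1 -> pure_unit p2 -> pure_unit q2 ->
  cos alpha1 != 0 -> cos beta1 != 0 -> cos alpha2 != 0 -> cos beta2 != 0 ->
  let pt1 := tan alpha1 *: p1 in
  let qt1 := tan beta1 *: q1 in
  let pt2 := tan alpha2 *: p2 in
  let qt2 := tan beta2 *: q2 in
  let f := gibbs alpha1 beta1 pt1 qt1 in
  let g := gibbs alpha2 beta2 pt2 qt2 in
  cos alpha = cos alpha1 * cos alpha2 * (1 - qdot pt1 pt2) ->
  cos beta = cos beta1 * cos beta2 * (1 - qdot qt1 qt2) ->
  cos alpha != 0 -> cos beta != 0 ->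
  let pt := (1 - qdot pt2 pt1)^-1 *: (pt2 + pt1 + qcross pt2 pt1) in
  let qt := (1 - qdot qt1 qt2)^-1 *: (qt1 + qt2 + qcross qt1 qt2) in
  let a_plus := tan beta *: pt + tan alpha *: qt in
  let b_plus := (tan alpha * tan beta)%:A - pt * qt in
  let a_minus := tan beta *: pt - tan alpha *: qt in
  let b_minus := (tan alpha * tan beta)%:A + pt * qt in
  a_plus != 0 -> a_minus != 0 -> b_plus != 0 -> b_minus != 0 ->
  let h := g \o f in
  let P_plus := <<[:: a_plus; b_plus]>>%VS in
  let P_minus := <<[:: a_minus; b_minus]>>%VS in
  is_rotation h /\
  (\dim P_plus = 2%N /\ \dim P_minus = 2%N) /\
  orthogonal_subspaces P_plus P_minus /\
  (invariant_subspace h P_plus /\ invariant_subspace h P_minus) /\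
  rotates_plane h P_plus (alpha + beta) /\
  rotates_plane h P_minus (alpha - beta).
Proof.
move=> P1 Q1 P2 Q2 a1 b1 a2 b2 pt1 qt1 pt2 qt2 f g aE bE a0 b0 pt qt.
move=> a_plus b_plus a_minus b_minus _ _ bp0 bm0 h P_plus P_minus.
have aE' : cos alpha = cos alpha2 * cos alpha1 * (1 - qdot pt2 pt1).
  by rewrite aE qdotC [cos alpha1 * _]mulrC.
have [p [P ptE pM]] := versorM P2 P1 a2 a1 a0 aE'.
have [q [Q qtE qM]] := versorM Q1 Q2 b1 b2 b0 bE.
have hE : h = sandwich p q alpha beta.
  apply/funext => x; rewrite /h /= /f /g !gibbs_tan// /sandwich -pM -qM.
  by rewrite !mulrA.
(* The difference of the angles appears because a versor is unchanged when its
   axis and its angle are both negated. *)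
have hE' : h = sandwich p (- q) alpha (- beta).
  by rewrite hE; apply/funext => x; rewrite /sandwich versorNN.
have Q' := pure_unitN Q; set c := tan alpha * tan beta.
have b_plusE : b_plus = c *: (1 - p * q).
  by rewrite /b_plus /pt /qt ptE qtE -scalerAl -scalerAr scalerA scalerBr.
have b_minusE : b_minus = c *: (1 - p * - q).
  rewrite /b_minus /pt /qt ptE qtE -scalerAl -scalerAr scalerA.
  by rewrite mulrN opprK scalerDr.
have [ap ip] := intertwiner_one_minus_mul c P Q.
have [am im] := intertwiner_one_minus_mul c P Q'.
rewrite -b_plusE in ap ip; rewrite -b_minusE in am im.
have a_plusE : a_plus = p * b_plus.
  by rewrite ap /a_plus /pt /qt ptE qtE !scalerA scalerDr [tan beta * _]mulrC.
have a_minusE : a_minus = p * b_minus.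
  by rewrite am /a_minus /pt /qt ptE qtE !scalerA scalerBr [tan beta * _]mulrC.
have rp : rotates_plane h P_plus (alpha + beta).
  by rewrite hE /P_plus a_plusE; exact: sandwich_rotates_plane.
have rm : rotates_plane h P_minus (alpha - beta).
  by rewrite hE' /P_minus a_minusE; exact: sandwich_rotates_plane.
split; first by rewrite hE; exact: sandwich_is_rotation.
split; first by split; apply: rotates_plane_dim; eassumption.
split; last by do 2?split=> //; apply: rotates_plane_invariant; eassumption.
move=> x y; rewrite /P_plus /P_minus a_plusE a_minusE => xP yP.
apply: (@intertwine_orthogonal _ p q) => //.
  exact: (@intertwine_span _ p q b_plus).
by rewrite -mulrN; apply: (@intertwine_span _ p (- q) b_minus).
Qed.
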